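(* Let $Y$ be a sublattice of a lattice-normed vector lattice $X=(X,p,E)$. Then $Y$ is $up$-regular in each of the following cases: (i) $Y$ is majorizing in $X$; (ii) $Y$ is $p$-dense in $X$; (iii) $Y$ is a projection band in $X$.
   Context: All vector lattices are real and Archimedean. A net $(x_\alpha)$ in a vector lattice is order convergent to $x$ ($x_\alpha\xrightarrow{o}x$) if there is a net $(y_\beta)$ (possibly with a different index set) with $y_\beta\downarrow 0$ such that for each $\beta$ there is $\alpha_\beta$ with $|x_\alpha-x|\le y_\beta$ for all $\alpha\ge\alpha_\beta$. A lattice-normed vector lattice (LNVL) is a triple $(X,p,E)$, where $X$ and $E$ are vector lattices and $p:X\to E_+$ satisfies: $p(x)=0\Leftrightarrow x=0$; $p(\lambda x)=|\lambda|p(x)$; $p(x+y)\le p(x)+p(y)$; and $|x|\le|y|\Rightarrow p(x)\le p(y)$. For a net $y_\alpha$ in $Y$: $y_\alpha\xrightarrow{up}0$ in $X$ means $p(|y_\alpha|\wedge u)\xrightarrow{o}0$ in $E$ for every $u\in X_+$, and $y_\alpha\xrightarrow{up}0$ in $Y$ means $p(|y_\alpha|\wedge u)\xrightarrow{o}0$ in $E$ for every $u\in Y_+$. The sublattice $Y$ is $up$-regular if for any net $y_\alpha$ in $Y$, $y_\alpha\xrightarrow{up}0$ in $Y$ implies $y_\alpha\xrightarrow{up}0$ in $X$. $Y$ is majorizing in $X$ if for each $x\in X$ there is $y\in Y$ with $x\le y$. $Y$ is $p$-dense in $X$ if for every $x\in X$ and every $0\ne u\in p(X)$ there is $y\in Y$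 with $p(x-y)\le u$. $Y$ is a projection band if it is a band with $X=Y\oplus Y^{\perp}$, where $Y^\perp$ is the disjoint complement of $Y$. *)

(* Defs.v *)
From HB Require Import structures.
From mathcomp Require Import all_boot all_order all_algebra.
From mathcomp Require Import boolp classical_sets reals.

Set Implicit Arguments.
Unset Strict Implicit.
Unset Printing Implicit Defensive.

Import Order.TTheory GRing.Theory Num.Theory.

Local Open Scope classical_set_scope.
Local Open Scope ring_scope.

(* The lattice operations are fields of the mixin: HB refuses a structure      *)
(* inheriting from both GRing.Lmodule and Order.Lattice, because Num.RealDomain *)
(* has no ancestor that joins Order.Lattice with GRing.Zmodule.                *)
HB.mixin Record isVectorLattice (R : realType) (X : Type)
    of GRing.Lmodule R X & Num.POrderedZmodule X := {
  vl_leD2r : forall z x y : X, x <= y -> x + z <= y + z;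
  vl_leZ2l : forall (a : R) (x y : X), 0 <= a -> x <= y -> a *: x <= a *: y;
  vjoin : X -> X -> X;
  vmeet : X -> X -> X;
  vjoin_le : forall x y z : X, (vjoin x y <= z) = (x <= z) && (y <= z);
  vmeet_ge : forall x y z : X, (z <= vmeet x y) = (z <= x) && (z <= y)
}.

#[short(type="vectorLatticeType")]
HB.structure Definition VectorLattice (R : realType) :=
  { X of GRing.Lmodule R X & Num.POrderedZmodule X & isVectorLattice R X }.

(* The modulus is an element of the lattice itself, unlike the scalar-valued  *)
(* norm `|x| of a normedZmodType.                                             *)
Definition modulus (R : realType) (X : vectorLatticeType R) (x : X) : X :=
  vjoin x (- x).

Definition archimedean_vl (R : realType) (X : vectorLatticeType R) : Prop :=
  forall x : X, 0 <= x ->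
    infimums (range (fun n : nat => n.+1%:R^-1 *: x)) 0.

Record directedSet := DirectedSet {
  dset_sort :> Type;
  dset_le : dset_sort -> dset_sort -> Prop;
  dset_point : dset_sort;
  dset_refl : forall a, dset_le a a;
  dset_trans : forall a b c, dset_le a b -> dset_le b c -> dset_le a c;
  dset_directed : forall a b, exists c, dset_le a c /\ dset_le b c
}.

Definition net_decreases_to (R : realType) (E : vectorLatticeType R)
    (B : directedSet) (y : B -> E) (l : E) : Prop :=
  (forall b c : B, dset_le b c -> y c <= y b) /\ infimums (range y) l.

Definition order_cvg (R : realType) (E : vectorLatticeType R)
    (A : directedSet) (x : A -> E) (l : E) : Prop :=
  exists (B : directedSet) (y : B -> E), net_decreases_to y 0 /\
    forall b : B, exists a0 : A, forall a : A, dset_le a0 a ->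
      modulus (x a - l) <= y b.

Definition vector_sublattice (R : realType) (X : vectorLatticeType R)
    (Y : set X) : Prop :=
  submod_closed (mem Y) /\
  forall x y : X, Y x -> Y y -> Y (vmeet x y) /\ Y (vjoin x y).

Definition order_ideal (R : realType) (X : vectorLatticeType R)
    (Y : set X) : Prop :=
  submod_closed (mem Y) /\
  forall x y : X, Y y -> modulus x <= modulus y -> Y x.

Definition order_closed (R : realType) (X : vectorLatticeType R)
    (Y : set X) : Prop :=
  forall (A : directedSet) (x : A -> X) (l : X),
    (forall a, Y (x a)) -> order_cvg x l -> Y l.

Definition band (R : realType) (X : vectorLatticeType R)
    (Y : set X) : Prop :=
  order_ideal Y /\ order_closed Y.

Definition disjoint_complement (R : realType) (X : vectorLatticeType R)
    (Y : set X) : set X :=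
  [set x | forall y, Y y -> vmeet (modulus x) (modulus y) = 0].

(* The last two clauses spell out the direct sum X = Y (+) Y^perp.            *)
Definition projection_band (R : realType) (X : vectorLatticeType R)
    (Y : set X) : Prop :=
  [/\ band Y,
      [set y + z | y in Y & z in disjoint_complement Y] = setT
    & Y `&` disjoint_complement Y = [set 0]].

Definition majorizing (R : realType) (X : vectorLatticeType R)
    (Y : set X) : Prop :=
  forall x : X, exists2 y, Y y & x <= y.

Record lattice_norm (R : realType) (X E : vectorLatticeType R)
    (p : X -> E) : Prop := LatticeNorm {
  lnorm_ge0 : forall x, 0 <= p x;
  lnorm_eq0 : forall x, p x = 0 <-> x = 0;
  lnormZ : forall (a : R) x, p (a *: x) = `|a| *: p x;
  lnormD : forall x y, p (x + y) <= p x + p y;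
  lnorm_mono : forall x y, modulus x <= modulus y -> p x <= p y
}.

(* up-convergence to 0 tested against the positive elements of D: D = setT is *)
(* up-convergence in X, and D = Y is up-convergence in the sublattice Y.      *)
Definition up_cvg0 (R : realType) (X E : vectorLatticeType R) (p : X -> E)
    (D : set X) (A : directedSet) (y : A -> X) : Prop :=
  forall u : X, D u -> 0 <= u ->
    order_cvg (fun a => p (vmeet (modulus (y a)) u)) 0.

Definition up_regular (R : realType) (X E : vectorLatticeType R) (p : X -> E)
    (Y : set X) : Prop :=
  forall (A : directedSet) (y : A -> X), (forall a, Y (y a)) ->
    up_cvg0 p Y y -> up_cvg0 p setT y.

Definition p_dense (R : realType) (X E : vectorLatticeType R) (p : X -> E)
    (Y : set X) : Prop :=
  forall (x : X) (u : E), range p u -> u <> 0 ->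
    exists2 y, Y y & p (x - y) <= u.

(* Main.v *)
(* Case (ii): for y in Y one has p(|y_a| /\ u) <= p(u - y) + p(|y_a| /\ |y|),
   and p-density makes p(u - y) at most p(u)/n. As E is Archimedean, the
   elements of E that eventually dominate p(|y_a| /\ u) have infimum 0. They
   are closed under meets, so they form a net decreasing to 0. In cases (i) and
   (iii), |y_a| /\ u is dominated by |y_a| /\ v for a single positive v in Y. *)
Require Import Defs.
From mathcomp Require Import all_boot all_order all_algebra.
From mathcomp Require Import boolp classical_sets reals.

Import Order.TTheory GRing.Theory Num.Theory.

Local Open Scope classical_set_scope.
Local Open Scope ring_scope.

Section VectorLattice.
Context {R : realType} {X : vectorLatticeType R}.
Implicit Types x y z u v : X.

Lemma vl_lerBlDr z x y : (x - z <= y) = (x <= y + z).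
Proof.
apply/idP/idP => [/(vl_leD2r z)|/(vl_leD2r (- z))]; first by rewrite subrK.
by rewrite addrK.
Qed.

Lemma vl_lerBlDl z x y : (x - z <= y) = (x <= z + y).
Proof. by rewrite vl_lerBlDr addrC. Qed.

Lemma vl_lerD x y u v : x <= y -> u <= v -> x + u <= y + v.
Proof.
move=> xy uv; apply: (le_trans (vl_leD2r u _ _ xy)).
by rewrite ![y + _]addrC; exact: vl_leD2r.
Qed.

Lemma vmeet_lel x y : vmeet x y <= x.
Proof. by have := lexx (vmeet x y); rewrite vmeet_ge => /andP[]. Qed.

Lemma vmeet_ler x y : vmeet x y <= y.
Proof. by have := lexx (vmeet x y); rewrite vmeet_ge => /andP[]. Qed.

Lemma vmeetC x y : vmeet x y = vmeet y x.
Proof. by apply: le_anti; rewrite !vmeet_ge !vmeet_lel !vmeet_ler. Qed.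

Lemma vmeet_ge0 x y : 0 <= x -> 0 <= y -> 0 <= vmeet x y.
Proof. by rewrite vmeet_ge => -> ->. Qed.

Lemma vmeet_leS x y z : y <= z -> vmeet x y <= vmeet x z.
Proof.
by move=> yz; rewrite vmeet_ge vmeet_lel (le_trans (vmeet_ler x y) yz).
Qed.

(** With [t] the left side, [t - vmeet x y] is below [x] because [t <= x] and [vmeet x y] is
    positive. It is below [z] because [t - z] is below both [x] and [y]. *)
Lemma vmeet_subadd x y z : 0 <= x -> 0 <= y -> 0 <= z ->
  vmeet x (y + z) <= vmeet x y + vmeet x z.
Proof.
move=> x0 y0 z0; set t := vmeet x (y + z).
have t_le u : 0 <= u -> t <= u + x.
  by move=> u0; have := vl_lerD _ _ _ _ u0 (vmeet_lel x (y + z)); rewrite add0r.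
rewrite -vl_lerBlDl vmeet_ge !vl_lerBlDl t_le ?vmeet_ge0 //=.
by rewrite -vl_lerBlDr vmeet_ge !vl_lerBlDr vmeet_ler addrC t_le.
Qed.

Lemma ler_modulus x : x <= modulus x.
Proof.
by have := lexx (modulus x); rewrite {1}/modulus vjoin_le => /andP[].
Qed.

Lemma lerN_modulus x : - x <= modulus x.
Proof.
by have := lexx (modulus x); rewrite {1}/modulus vjoin_le => /andP[].
Qed.

(** Adding [x <= modulus x] and [- x <= modulus x] gives twice the modulus above 0; scaling by one
    half concludes. *)
Lemma modulus_ge0 x : 0 <= modulus x.
Proof.
have := vl_lerD _ _ _ _ (ler_modulus x) (lerN_modulus x).
rewrite subrr -mulr2n -scaler_nat => /(@vl_leZ2l R X 2^-1).
by rewrite invr_ge0 ler0n scaler0 scalerA mulVf ?pnatr_eq0 // scale1r; apply.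
Qed.

Lemma ger0_modulus x : 0 <= x -> modulus x = x.
Proof.
move=> x0; apply/le_anti; rewrite ler_modulus andbT vjoin_le lexx /=.
by rewrite -sub0r vl_lerBlDr -[0]addr0 vl_lerD.
Qed.

(** Subadditivity of the meet applied to [u <= modulus (u - v) + modulus v]. It trades the test
    element [u] for [modulus v], with an error controlled by [u - v]. *)
Lemma vmeet_modulus_split x u v : 0 <= u ->
  vmeet (modulus x) u <=
  vmeet (modulus x) (modulus (u - v)) + vmeet (modulus x) (modulus v).
Proof.
move=> u0.
apply: (le_trans _ (vmeet_subadd _ _ _ (modulus_ge0 _) (modulus_ge0 _) (modulus_ge0 _))).
by apply: vmeet_leS; rewrite -{1}(subrK v u) vl_lerD ?ler_modulus.
Qed.

Lemma vector_sublattice_modulus (Y : set X) x :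
  vector_sublattice Y -> Y x -> Y (modulus x).
Proof.
move=> [[Y0 Ylin] Yl] Yx; apply: (proj2 (Yl _ _ Yx _)).
suff : - x \in mem Y by rewrite in_setE.
by rewrite -scaleN1r -[_ *: _]addr0; apply: Ylin => //; rewrite in_setE.
Qed.

End VectorLattice.

Section OrderConvergence.
Context {R : realType} {E : vectorLatticeType R} {A : directedSet}.
Implicit Types x z : A -> E.

Definition eventual_ubounds x : set E :=
  [set s | exists a0 : A, forall a, dset_le a0 a -> x a <= s].

Lemma order_cvg0_le x z : (forall a, 0 <= x a) -> (forall a, x a <= z a) ->
  order_cvg z 0 -> order_cvg x 0.
Proof.
move=> x0 xz [B [b [bd bz]]]; exists B, b; split=> // i.
have [a0 za0] := bz i; exists a0 => a /za0.
rewrite !subr0 (ger0_modulus (x a)) //; apply: le_trans.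
exact: (le_trans (xz a) (ler_modulus _)).
Qed.

Lemma eventual_ubounds_order_cvg0 x : (forall a, 0 <= x a) ->
  infimums (eventual_ubounds x) 0 -> order_cvg x 0.
Proof.
move=> x0 infx; set S := eventual_ubounds x.
(* If [S] were empty, every [x a] would vacuously be a lower bound of it, hence [x a <= 0], which
   puts 0 in [S]. *)
have [s0 Ss0] : S !=set0.
  apply/set0P/negP => /eqP S0.
  suff : S 0 by rewrite S0.
  exists (dset_point A) => a _; apply: infx.2.
  by move=> s; rewrite -/S S0.
(* [S] indexes itself under the reversed order, so that the inclusion [sval] is a decreasing net. A
   common later index in [A] shows that [S] is closed under meets, whence directedness. *)
pose le (s t : {s | S s}) := (sval t <= sval s : Prop).
have le_refl s : le s s by exact: lexx.
have le_tr s t r : le s t -> le t r -> le s r.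
  by move=> st tr; exact: le_trans tr st.
have le_dir s t : exists r, le s r /\ le t r.
  case: s t => [s Ss] [t St].
  have Sst : S (vmeet s t).
    have [a sa] := Ss; have [b tb] := St.
    have [c [ac bc]] := dset_directed a b.
    exists c => d cd; rewrite vmeet_ge sa ?tb //.
      exact: dset_trans bc cd.
    exact: dset_trans ac cd.
  by exists (exist _ _ Sst); split; [exact: vmeet_lel|exact: vmeet_ler].
exists (@DirectedSet _ le (exist _ s0 Ss0) le_refl le_tr le_dir), sval; split.
  split=> //; suff -> : range (sval : {s | S s} -> E) = S by [].
  apply/seteqP; split=> [_ [[s Ss] _ <-] //|s Ss].
  by exists (exist _ s Ss).
move=> [s [a0 sa0]]; exists a0 => a /sa0.
by rewrite subr0 ger0_modulus.
Qed.

(** If [b] decreases to 0 and dominates [z], each [w + b i] eventually bounds [x]. A lower bound [l]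
    of the eventual bounds thus has [l - w <= b i] for all [i], so [l <= w]; as [w] ranges over [W],
    [l <= 0]. *)
Lemma order_cvg0_approx x (W : set E) : (forall a, 0 <= x a) -> infimums W 0 ->
  (forall w, W w ->
    exists2 z, order_cvg z 0 & forall a, x a <= w + z a) ->
  order_cvg x 0.
Proof.
move=> x0 infW xW; apply: eventual_ubounds_order_cvg0 => //; split=> [s [a0 sa0]|l lS].
  exact: le_trans (x0 a0) (sa0 _ (dset_refl a0)).
apply: infW.2 => w Ww; have [z [B [b [[_ infb] bz]]] xz] := xW w Ww.
suff : l - w <= 0 by rewrite vl_lerBlDr add0r.
apply: infb.2 => _ [i _ <-]; rewrite vl_lerBlDl; apply: lS.
have [a0 zb] := bz i; exists a0 => a /zb zab.
apply: (le_trans (xz a)); apply: vl_lerD => //.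
by apply: le_trans zab; rewrite subr0 ler_modulus.
Qed.

End OrderConvergence.

Section UpRegularity.
Context {R : realType} {X E : vectorLatticeType R} {p : X -> E}.
Context (hp : lattice_norm p).

Lemma lattice_norm_le x y : 0 <= x -> x <= y -> p x <= p y.
Proof.
move=> x0 xy; apply: (lnorm_mono hp).
by rewrite !ger0_modulus //; apply: le_trans xy.
Qed.

(** The element [v] is chosen before [y], so one convergence tested in [Y] dominates the whole net
    tested against [u]. *)
Lemma up_regular_dominated (Y : set X) :
  (forall u, 0 <= u -> exists v, [/\ Y v, 0 <= v &
     forall y, Y y -> vmeet (modulus y) u <= vmeet (modulus y) v]) ->
  up_regular p Y.
Proof.
move=> dom A y Yy cvgY u _ u0; have [v [Yv v0 uv]] := dom u u0.
apply: order_cvg0_le (cvgY v Yv v0) => a; first exact: lnorm_ge0.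
by apply: lattice_norm_le (uv _ (Yy a)); rewrite vmeet_ge0 ?modulus_ge0.
Qed.

Lemma majorizing_up_regular (Y : set X) : majorizing Y -> up_regular p Y.
Proof.
move=> maj; apply: up_regular_dominated => u u0; have [v Yv uv] := maj u.
by exists v; split=> // [|y _]; [exact: le_trans uv|exact: vmeet_leS].
Qed.

Lemma projection_band_up_regular (Y : set X) :
  vector_sublattice Y -> projection_band Y -> up_regular p Y.
Proof.
move=> hY [_ sumY _]; apply: up_regular_dominated => u u0.
have [v Yv [z Yz uE]] : [set y + z | y in Y & z in disjoint_complement Y] u.
  by rewrite sumY.
exists (modulus v); split; [exact: vector_sublattice_modulus|exact: modulus_ge0|].
move=> y Yy; apply: (le_trans (vmeet_modulus_split y u v u0)).
(* The error [u - v] is the component of [u] disjoint from [Y], so its meet with [modulus y]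
   vanishes. *)
have -> : u - v = z by rewrite -uE addrC addKr.
by rewrite [vmeet _ (modulus z)]vmeetC Yz // add0r.
Qed.

Lemma p_dense_up_regular (Y : set X) : archimedean_vl E ->
  vector_sublattice Y -> p_dense p Y -> up_regular p Y.
Proof.
move=> hE hY dense A y Yy cvgY u _ u0.
(* [p_dense] admits only nonzero bounds, so [u = 0] is treated apart: it lies in [Y] and is already
   a test element there. *)
have [uE|u_neq0] := eqVneq u 0.
  by apply: cvgY => //; rewrite uE -in_setE; exact: hY.1.1.
apply: order_cvg0_approx (hE _ (lnorm_ge0 hp u)) _ => [a|_ [n _ <-]].
  exact: lnorm_ge0.
set w := _ *: _.
(* The bounds in [p_dense] must be values of [p]; homogeneity makes [w] one. *)
have wE : p (n.+1%:R^-1 *: u) = w.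
  by rewrite lnormZ // ger0_norm // invr_ge0 ler0n.
have w_neq0 : w <> 0.
  rewrite -wE => /(lnorm_eq0 hp)/eqP.
  by rewrite scaler_eq0 invr_eq0 pnatr_eq0 (negPf u_neq0).
have [v Yv uv] := dense u w (ex_intro2 _ _ _ I wE) w_neq0.
exists (fun a => p (vmeet (modulus (y a)) (modulus v))).
  by apply: cvgY; [exact: vector_sublattice_modulus|exact: modulus_ge0].
move=> a; have mge0 t : 0 <= t -> 0 <= vmeet (modulus (y a)) t.
  by move=> t0; rewrite vmeet_ge0 ?modulus_ge0.
apply: (le_trans (lattice_norm_le _ _ (mge0 _ u0) (vmeet_modulus_split _ _ v u0))).
apply: (le_trans (lnormD hp _ _)); apply: vl_lerD => //.
(* The remaining meet is at most [modulus (u - v)], whose norm the choice of [v] keeps below [w]. *)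
apply: le_trans uv; apply: (lnorm_mono hp).
by rewrite ger0_modulus ?mge0 ?modulus_ge0 // vmeet_ler.
Qed.

End UpRegularity.

Theorem theorem4p3 (R : realType) (X E : vectorLatticeType R)
    (hX : archimedean_vl X) (hE : archimedean_vl E)
    (p : X -> E) (hp : lattice_norm p)
    (Y : set X) (hY : vector_sublattice Y) :
  [/\ majorizing Y -> up_regular p Y,
      p_dense p Y -> up_regular p Y
    & projection_band Y -> up_regular p Y].
Proof.
split.
- exact: majorizing_up_regular.
- exact: p_dense_up_regular.
- exact: projection_band_up_regular.
Qed.
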